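(* Let $m=2^k$ with $k\in\mathbb{N}$, $k\geq1$. Then there exists an odd integer $a$ with $1\leq a<m$ such that $K_{\mathbb{C}}(a/m)\leq 8$.
   Context: For $z\in\mathbb{C}$, $[z]:=\lfloor \mathrm{Re}(z)+\tfrac12\rfloor+i\lfloor \mathrm{Im}(z)+\tfrac12\rfloor$. Let $\mathfrak{F}=\{z\in\mathbb{C}: -\tfrac12\leq\mathrm{Re}(z)<\tfrac12,\ -\tfrac12\leq\mathrm{Im}(z)<\tfrac12\}$ and $T:\mathfrak{F}\to\mathfrak{F}$, $T(z)=z^{-1}-[z^{-1}]$ for $z\neq0$, $T(0)=0$. For $z\in\mathfrak{F}\setminus\{0\}$, $a_1(z)=[z^{-1}]$ and, while $T^{n-1}(z)\neq0$, $a_n(z)=a_1(T^{n-1}(z))$. For general $z\in\mathbb{C}$, $a_0(z)=[z]$ and $a_n(z)=a_n(z-a_0(z))$ for $n\geq1$. For $z\in\mathbb{Q}(i)$ the sequence terminates, giving the Hurwitz continued fraction $[a_0(z);a_1(z),\ldots,a_n(z)]_{\mathbb{C}}$, and $K_{\mathbb{C}}(z):=\max(|a_1(z)|,\ldots,|a_n(z)|)$ (the term $a_0$ is not included). *)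

(* Defs.v *)
From HB Require Import structures.
From mathcomp Require Import all_boot all_order all_algebra.
From mathcomp Require Import complex.
From mathcomp Require Import boolp reals.
From mathcomp Require Import ring lra.

Set Implicit Arguments.
Unset Strict Implicit.
Unset Printing Implicit Defensive.

Import Order.TTheory GRing.Theory Num.Theory.
Import ComplexField.Normc.

Local Open Scope ring_scope.
Local Open Scope complex_scope.

Definition hround (R : realType) (z : R[i]) : R[i] :=
  (Num.floor (complex.Re z + 1 / 2))%:~R +i* (Num.floor (complex.Im z + 1 / 2))%:~R.

Definition hdomain (R : realType) (z : R[i]) : Prop :=
  - (1 / 2) <= complex.Re z < 1 / 2 /\ - (1 / 2) <= complex.Im z < 1 / 2.

(* The Hurwitz map, totalised to R[i]; by [hmap_hdomain] its values lie in the
   domain, and below it is only iterated from points of the domain. *)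
Definition hmap (R : realType) (z : R[i]) : R[i] :=
  if z == 0 then 0 else z^-1 - hround z^-1.

(* [horbit z n] is T^n(z - a_0(z)). *)
Definition horbit (R : realType) (z : R[i]) (n : nat) : R[i] :=
  iter n (@hmap R) (z - hround z).

(* The partial quotient a_n(z); for n = k+1 it is meaningful only while
   [horbit z k != 0]. *)
Definition hquot (R : realType) (z : R[i]) (n : nat) : R[i] :=
  if n is k.+1 then hround (horbit z k)^-1 else hround z.

Definition hterminates (R : realType) (z : R[i]) : Prop :=
  exists n, horbit z n == 0.

(* The index n of the last partial quotient of a terminating expansion
   [a_0; a_1, ..., a_n], i.e. the least n with T^n(z - a_0(z)) = 0.  The value 0
   in the other case is a dummy, never reached on Q(i) by
   [hterminates_gaussian_rational]. *)
Definition hlength (R : realType) (z : R[i]) : nat :=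
  if pselect (hterminates z) is left zfin then ex_minn zfin else 0%N.

(* The largest modulus of a_1(z), ..., a_n(z), with n = hlength z, as a real
   number; it is 0 when z is a Gaussian integer. *)
Definition hK (R : realType) (z : R[i]) : R :=
  \big[Num.max/0]_(1 <= j < (hlength z).+1) normc (hquot z j).

Lemma hdomain_frac (R : realType) (z : R[i]) : hdomain (z - hround z).
Proof.
case: z => x y; rewrite /hdomain /=.
have /andP[x1 x2] := Num.Theory.floor_itv (x + 1 / 2).
have /andP[y1 y2] := Num.Theory.floor_itv (y + 1 / 2).
by move: x2 y2; rewrite !intrD => x2 y2; split; lra.
Qed.

Lemma hmap_hdomain (R : realType) (z : R[i]) : hdomain (hmap z).
Proof.
by rewrite /hmap; case: eqP => _; [rewrite /hdomain /=; split; lra | exact: hdomain_frac].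
Qed.

Section Termination.
Variable R : realType.
Implicit Types p q : R[i].

Let gint p := complex.Re p \is a Num.int /\ complex.Im p \is a Num.int.
Let nsq p := complex.Re p ^+ 2 + complex.Im p ^+ 2.

Let nsqM p q : nsq (p * q) = nsq p * nsq q.
Proof. by case: p q => [a b] [c d]; rewrite /nsq /=; ring. Qed.

Let nsq_eq0 p : nsq p = 0 -> p = 0.
Proof.
case: p => a b /eqP; rewrite /nsq /= paddr_eq0 ?sqr_ge0 // !sqrf_eq0.
by case/andP=> /eqP -> /eqP ->.
Qed.

Let gint_round p : gint (hround p).
Proof. by split; rewrite /= intr_int. Qed.

Let gintB p q : gint p -> gint q -> gint (p - q).
Proof. by case: p q => [a b] [c d] [/= ? ?] [/= ? ?]; split; apply: rpredB. Qed.

Let gintM p q : gint p -> gint q -> gint (p * q).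
Proof.
case: p q => [a b] [c d] [/= ? ?] [/= ? ?].
by split; rewrite ?rpredB ?rpredD ?rpredM.
Qed.

Let nsq_frac p : nsq (p - hround p) <= 1 / 2.
Proof.
have [] := hdomain_frac p; rewrite /nsq; set x := complex.Re _; set y := complex.Im _.
by move=> /andP[? ?] /andP[? ?]; nra.
Qed.

Let nsq_nat p : gint p -> exists n : nat, nsq p = n%:R.
Proof.
move=> [pr pim]; have /natrP[n ->] : nsq p \is a Num.nat.
  by rewrite natrEint rpredD ?rpredX //= addr_ge0 ?sqr_ge0.
by exists n.
Qed.

Let iter_hmap_eq0 N p q : gint p -> gint q -> nsq p < N%:R ->
  exists n, iter n (@hmap R) (p / q) == 0.
Proof.
elim: N p q => [|N IH] p q gp gq; first by rewrite ltNge addr_ge0 ?sqr_ge0.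
move=> pN; have [pq0|pq0] := eqVneq (p / q) 0; first by exists 0%N; rewrite /= pq0.
have [p0 q0] : p != 0 /\ q != 0.
  by move: pq0; rewrite mulf_eq0 invr_eq0 negb_or => /andP[].
pose a := hround (q / p).
have E : hmap (p / q) = (q - a * p) / p.
  by rewrite /hmap (negPf pq0) invf_div -/a mulrBl mulfK.
have ga : gint (q - a * p) := gintB gq (gintM (gint_round _) gp).
suff lt_aN : nsq (q - a * p) < N%:R.
  by have [n /eqP nE] := IH _ _ ga gp lt_aN; exists n.+1; rewrite iterSr E nE.
have -> : q - a * p = (q / p - a) * p by rewrite mulrBl divfK.
have [m mE] := nsq_nat gp.
have np : 0 < nsq p.
  rewrite lt_neqAle addr_ge0 ?sqr_ge0 // andbT eq_sym.
  by apply: contra p0 => /eqP/nsq_eq0/eqP.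
have : m%:R < (N.+1)%:R :> R by rewrite -mE.
rewrite ltr_nat ltnS -(ler_nat R) -mE => pN'.
by rewrite nsqM; have := nsq_frac (q / p); rewrite -/a => ?; nra.
Qed.

Lemma hterminates_gaussian_rational (x y : rat) :
  hterminates (ratr x +i* ratr y : R[i]).
Proof.
set z : R[i] := ratr x +i* ratr y; rewrite /hterminates /horbit.
pose d : R := (denq x)%:~R * (denq y)%:~R.
pose p : R[i] := ((numq x)%:~R * (denq y)%:~R) +i* ((numq y)%:~R * (denq x)%:~R).
pose q : R[i] := d +i* 0.
have dx : (denq x)%:~R != 0 :> R by rewrite intr_eq0 denq_neq0.
have dy : (denq y)%:~R != 0 :> R by rewrite intr_eq0 denq_neq0.
have q0 : q != 0 by rewrite eq_complex /= negb_and mulf_neq0.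
have zq : z * q = p.
  apply/eqP; rewrite eq_complex /= !mulr0 subr0 add0r /d /ratr; apply/andP.
  split; apply/eqP; field; rewrite ?dx ?dy //.
have gp : gint p by split; rewrite /= rpredM ?intr_int.
have gq : gint q by split; rewrite /= ?rpred0 // rpredM ?intr_int.
have -> : z - hround z = (p - hround z * q) / q by rewrite -zq -mulrBl mulfK.
have gr : gint (p - hround z * q) := gintB gp (gintM (gint_round _) gq).
have [n nE] := nsq_nat gr.
by apply: (@iter_hmap_eq0 n.+1) => //; rewrite nE ltr_nat.
Qed.

End Termination.

(* Main.v *)
(** For a real argument the Hurwitz expansion is the nearest-integer continued
    fraction.  A word of integers of modulus at least 3 is always the
    nearest-integer expansion of its value, whatever the signs, so such words
    may be reversed, negated and concatenated freely.  If the word [s] has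
    value [p/q], the folded word [s, c, -rev s] has value
    [(c p q +- 1) / (c q^2)]; with [c = 4] and [c = 8] this turns an expansion
    with denominator [2^k] into expansions with denominators [2^(2k+2)] and
    [2^(2k+3)], with all digits of modulus between 3 and 8.  Starting from
    [k = 2, 3, 4, 12, 13] one reaches every [k] except 1 and 5, which have no
    such word and are treated with [1/2] and [15/32]. *)

Require Import Defs.
From mathcomp Require Import all_boot all_order all_algebra.
From mathcomp Require Import complex.
From mathcomp Require Import boolp reals.
From mathcomp Require Import zify ring lra.

Import Order.TTheory GRing.Theory Num.Theory.
Import ComplexField.Normc.

Local Open Scope ring_scope.
Local Open Scope complex_scope.

(** * Words of integer digits and their values *)

Definition cf_val (R : realType) (s : seq int) : R :=
  foldr (fun a x => (a%:~R + x)^-1) 0 s.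

(* The column [(p, q)] with [p / q] the value of [s] is [cf_act s (0, 1)]. *)
Definition cf_act (s : seq int) (v : int * int) : int * int :=
  foldr (fun a w => (w.2, w.1 + a * w.2)) v s.

Definition cf_fold (c : int) (s : seq int) : seq int :=
  s ++ c :: map -%R (rev s).

Definition digits_between (l u : int) (s : seq int) : bool :=
  all (fun a => l <= `|a| <= u) s.

(** The interval condition on each tail makes rounding return the digit. It also admits some words
    with digits of modulus 2, as [k = 1] and [k = 5] require. *)
Fixpoint nearest_admissible (R : realType) (u : int) (s : seq int) : Prop :=
  if s is a :: t then
    [/\ a != 0, `|a| <= u, - (1 / 2) <= cf_val R t < 1 / 2
      & nearest_admissible R u t]
  else True.

(** * The Hurwitz map on values of words *)

Section HurwitzOfReal.
Variable R : realType.
Implicit Types (x : R) (a u : int) (s : seq int).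

Lemma hround_real a x : - (1 / 2) <= x < 1 / 2 ->
  hround (a%:~R + x)%:C = a%:~R%:C.
Proof.
move=> /andP[x1 x2]; rewrite /hround /=; congr (_ +i* _).
  by congr (_%:~R); apply: floor_def; rewrite intrD; apply/andP; split; lra.
by rewrite (_ : Num.floor _ = 0) //; apply: floor_def; apply/andP; split; lra.
Qed.

Lemma nearest_admissible_val_neq0 u a s :
  nearest_admissible R u (a :: s) -> a%:~R + cf_val R s != 0.
Proof.
case=> a0 _ /andP[s1 s2] _.
have [] : a <= - 1 \/ 1 <= a by lia.
  by rewrite -(ler_int R) => a1; apply/eqP; lra.
by rewrite -(ler_int R) => a1; apply/eqP; lra.
Qed.

Lemma hround_inv_cf_val u a s : nearest_admissible R u (a :: s) ->
  hround ((cf_val R (a :: s))%:C)^-1 = a%:~R%:C.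
Proof. by case=> _ _ s12 _; rewrite -fmorphV invrK hround_real. Qed.

Lemma hmap_cf_val u a s : nearest_admissible R u (a :: s) ->
  hmap (cf_val R (a :: s))%:C = (cf_val R s)%:C.
Proof.
move=> adm; rewrite /hmap ifN; last first.
  by rewrite fmorph_eq0 invr_eq0 (nearest_admissible_val_neq0 _ _ _ adm).
by rewrite (hround_inv_cf_val _ _ _ adm) -fmorphV invrK -rmorphB addrC addKr.
Qed.

Lemma nearest_admissible_drop u s n :
  nearest_admissible R u s -> nearest_admissible R u (drop n s).
Proof. by elim: n s => [|n IH] [|a s] //= [_ _ _ /IH]. Qed.

Lemma iter_hmap_cf_val u s n : nearest_admissible R u s ->
  iter n (@hmap R) (cf_val R s)%:C = (cf_val R (drop n s))%:C.
Proof.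
elim: n s => [|n IH] s; first by rewrite drop0.
case: s => [|a s] adm; last first.
  by rewrite iterSr (hmap_cf_val _ _ _ adm) IH //; case: adm.
(* Past the end of the word both sides stay 0, as [hmap] fixes 0. *)
by rewrite iterSr /hmap /= eqxx; have := IH [::] I; rewrite /= => ->.
Qed.

Lemma hK_le_nearest_admissible u s (z : R[i]) : 0 <= u ->
  nearest_admissible R u s -> z - hround z = (cf_val R s)%:C ->
  hK z <= u%:~R.
Proof.
move=> u0 adm zE.
have orbE n : horbit z n = (cf_val R (drop n s))%:C.
  by rewrite /horbit zE (iter_hmap_cf_val u).
have len : (hlength z <= size s)%N.
  rewrite /hlength; case: pselect => // zfin; case: ex_minnP => n _; apply.
  by rewrite orbE drop_size.
rewrite /hK big_seq; apply: bigmax_le; first by rewrite ler0z.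
move=> [|j]; rewrite mem_index_iota // ltnS => /andP[_ jlen].
have jlt : (j < size s)%N by apply: leq_trans len.
rewrite /hquot orbE.
have := nearest_admissible_drop u s j adm.
rewrite (drop_nth 0 jlt) => admj.
rewrite (hround_inv_cf_val _ _ _ admj); case: admj => _ aj _ _.
by rewrite /normc /= expr0n addr0 sqrtr_sqr -intr_norm ler_int.
Qed.

(** A bound [c < 1 / 2] with [1 / (3 - c) <= c] survives prepending a digit of modulus at least 3;
    [c = 2 / 5] is such a bound. *)
Lemma cf_val_norm_le s u : digits_between 3 u s -> `|cf_val R s| <= 2 / 5.
Proof.
elim: s => [|a s IH] /=; first by rewrite normr0; lra.
move=> /andP[/andP[a3 _] /IH {}IH].
rewrite normrV ?unitfE; last first.
  rewrite -normr_gt0; apply: lt_le_trans (lerB_normD _ _).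
  by rewrite -intr_norm; move: a3; rewrite -(ler_int R) => ?; lra.
have dlow : 5 / 2 <= `|a%:~R + cf_val R s|.
  apply: le_trans (lerB_normD _ _).
  by rewrite -intr_norm; move: a3; rewrite -(ler_int R) => ?; lra.
rewrite -[2 / 5]invrK lef_pV2 ?posrE ?invr_gt0; try lra.
Qed.

Lemma cf_val_itv s u : digits_between 3 u s -> - (1 / 2) <= cf_val R s < 1 / 2.
Proof.
by move=> /cf_val_norm_le; rewrite ler_norml => /andP[? ?]; apply/andP; split; lra.
Qed.

Lemma nearest_admissible_digits_between u s :
  digits_between 3 u s -> nearest_admissible R u s.
Proof.
elim: s => //= a s IH /andP[/andP[a3 au] sd]; split=> //; last exact: IH.
- by apply: contraTneq a3 => ->.
- exact: cf_val_itv sd.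
Qed.

Lemma cf_val_opp s : cf_val R (map -%R s) = - cf_val R s.
Proof. by elim: s => [|a s /= ->]; rewrite /= ?oppr0 // mulrNz -opprD invrN. Qed.

Lemma cf_val_act u s : nearest_admissible R u s ->
  (cf_act s (0, 1)).2 != 0 /\
  cf_val R s = (cf_act s (0, 1)).1%:~R / (cf_act s (0, 1)).2%:~R.
Proof.
elim: s => [|a s IH] adm; first by rewrite /= mul0r.
have d0 := nearest_admissible_val_neq0 _ _ _ adm.
have [q0 sE] : _ := IH ltac:(by case: adm).
rewrite [cf_val R _]/= [cf_act _ _]/= -/(cf_act s (0, 1)) /=.
case: (cf_act s (0, 1)) q0 sE => p q /= q0 sE.
have qR : q%:~R != 0 :> R by rewrite intr_eq0.
have E : a%:~R + cf_val R s = (p + a * q)%:~R / q%:~R.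
  by rewrite sE intrD intrM; field.
split; last by rewrite E invf_div.
by apply: contraNneq d0 => d0; rewrite E d0 mul0r.
Qed.

End HurwitzOfReal.

(** * Matrices of words and the folding identity *)

Lemma cf_act_lin s x y :
  cf_act s (x, y) = (x * (cf_act s (1, 0)).1 + y * (cf_act s (0, 1)).1,
                     x * (cf_act s (1, 0)).2 + y * (cf_act s (0, 1)).2).
Proof.
elim: s => [|a s IH] /=; first by congr pair; ring.
by rewrite -!/(cf_act s _) IH /=; congr pair; ring.
Qed.

Lemma cf_act_cat s t v : cf_act (s ++ t) v = cf_act s (cf_act t v).
Proof. exact: foldr_cat. Qed.

(** Each digit acts by a matrix of determinant -1. *)
Lemma cf_act_det s :
  (cf_act s (1, 0)).1 * (cf_act s (0, 1)).2
  - (cf_act s (0, 1)).1 * (cf_act s (1, 0)).2 = (-1) ^+ size s.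
Proof.
elim: s => [|a s IH] //=; rewrite -!/(cf_act s _) exprS -IH; ring.
Qed.

(* The matrix of [a] is symmetric and negating [a] conjugates it by
   [diag (1, -1)] up to sign, so the matrix of [- rev s] is that of [s]
   transposed and conjugated, up to sign. *)
Lemma cf_act_opp_rev s x y :
  cf_act (map -%R (rev s)) (x, y) =
  ((-1) ^+ size s * (x * (cf_act s (1, 0)).1 - y * (cf_act s (1, 0)).2),
   (-1) ^+ size s * (y * (cf_act s (0, 1)).2 - x * (cf_act s (0, 1)).1)).
Proof.
elim: s x y => [|a s IH] x y; first by rewrite /=; congr pair; ring.
rewrite rev_cons map_rcons -cats1 cf_act_cat /= IH -!/(cf_act s _) exprS.
by congr pair; ring.
Qed.

Lemma cf_act_fold c s : let: (p, q) := cf_act s (0, 1) in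
  cf_act (cf_fold c s) (0, 1) =
  ((-1) ^+ size s * (c * p * q) + 1, (-1) ^+ size s * (c * q ^+ 2)).
Proof.
have := cf_act_det s; rewrite /cf_fold cf_act_cat /= -/(cf_act _ _).
rewrite cf_act_opp_rev /= [cf_act s (_ * _, _)]cf_act_lin.
case: (cf_act s (0, 1)) => p q; case: (cf_act s (1, 0)) => p' q' /= det.
congr pair; last by ring.
(* The part free of [c] is the determinant of [s] times its own sign, hence 1. *)
transitivity ((-1) ^+ size s * (c * p * q) + (-1) ^+ size s * (p' * q - p * q')).
  by ring.
by rewrite det -expr2 sqrr_sign.
Qed.

Lemma digits_between_fold l u c s : l <= `|c| <= u ->
  digits_between l u s -> digits_between l u (cf_fold c s).
Proof.
move=> cb sb; rewrite /digits_between all_cat /= cb all_map all_rev.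
rewrite [all _ s]sb /=.
by apply: sub_all sb => a /=; rewrite normrN.
Qed.

(** * Words whose denominator is a power of two *)

Definition pow2_expansion (l u : int) (k : nat) : Prop :=
  exists s, [/\ digits_between l u s, odd (absz (cf_act s (0, 1)).1)
              & absz (cf_act s (0, 1)).2 = (2 ^ k)%N].

Lemma pow2_expansion_fold l u j k : (0 < j)%N -> l <= (2 ^ j)%N%:Z <= u ->
  pow2_expansion l u k -> pow2_expansion l u (2 * k + j).
Proof.
move=> j0 jb [s [sb _ sq]]; exists (cf_fold (2 ^ j)%N s).
have := cf_act_fold (2 ^ j)%N s.
case E : (cf_act s (0, 1)) sq => [p q] /= sq ->; split=> /=.
- exact: digits_between_fold.
(* Since [0 < j], the digit [c] is even, and the [+ 1] makes the new numerator odd. *)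
- have -> : (2 ^ j)%N%:Z = 2 * (2 ^ j.-1)%N%:Z.
    by rewrite -PoszM -expnS prednK.
  set e := (-1) ^+ _; set c := (2 ^ _)%N%:Z.
  have -> : e * (2 * c * p * q) + 1 = 2 * (e * c * p * q) + 1 by ring.
  by move: (e * c * p * q) => x; lia.
- by rewrite abszMsign abszM abszX sq -expnM -expnD addnC mulnC.
Qed.

Lemma pow2_expansion_3_8 k : (2 <= k)%N -> k <> 5%N -> pow2_expansion 3 8 k.
Proof.
elim/ltn_ind: k => k IH k2 k5.
(* Folding descends from [k] to [h = k./2 - 1]. This leaves the range of the induction exactly when
   [h] is 0, 1 or 5, so [k = 2, 3, 4, 12, 13] get explicit words. *)
have [->|k2'] := eqVneq k 2%N; first by exists [:: 4].
have [->|k3] := eqVneq k 3%N; first by exists [:: 8].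
have [->|k4] := eqVneq k 4%N; first by exists [:: 3; 5].
have [->|k12] := eqVneq k 12%N; first by exists [:: 8; 6; -3; -4; 7].
have [->|k13] := eqVneq k 13%N; first by exists [:: 8; -7; 7; 4; 5].
pose h := (k./2).-1.
have [hE|hE] : (k = 2 * h + 2 \/ k = 2 * h + 3)%N by rewrite /h; lia.
- by rewrite hE; apply: pow2_expansion_fold => //; apply: IH; lia.
- by rewrite hE; apply: pow2_expansion_fold => //; apply: IH; lia.
Qed.

(** * From words to the bound on [hK] *)

Lemma hK_ratio_le (R : realType) (u b : int) (s : seq int) (a m : nat) :
  0 <= u -> nearest_admissible R u s -> - (1 / 2) <= cf_val R s < 1 / 2 ->
  a%:R / m%:R = b%:~R + cf_val R s -> hK (a%:R / m%:R : R[i]) <= u%:~R.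
Proof.
move=> u0 adm sitv amE.
have zE : a%:R / m%:R = (b%:~R + cf_val R s)%:C :> R[i].
  by rewrite -amE fmorph_div !rmorph_nat.
apply: (@hK_le_nearest_admissible R u s) => //.
by rewrite zE hround_real // -rmorphB addrC addKr.
Qed.

Lemma pow2_expansion_ratio (R : realType) (u : int) (k : nat) :
  pow2_expansion 3 u k -> exists a s,
  [/\ odd a, (a < 2 ^ k)%N, digits_between 3 u s
    & a%:R / (2 ^ k)%:R = cf_val R s].
Proof.
case=> s [sb podd qE].
have [q0 sE] := cf_val_act R u s (nearest_admissible_digits_between R u s sb).
case: (cf_act s (0, 1)) podd qE q0 sE => p q /= podd qE q0 sE.
have normE : `|p|%N%:R / (2 ^ k)%:R = `|cf_val R s|.
  by rewrite sE normf_div -qE !natr_absz !intr_norm.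
(* Negating all digits, if needed, makes the value nonnegative and keeps the digit bounds. *)
have [t [tb tE]] : exists t, digits_between 3 u t /\ `|cf_val R s| = cf_val R t.
  have [_|_] := ger0P (cf_val R s); first by exists s.
  exists (map -%R s); rewrite cf_val_opp; split=> //.
  by rewrite /digits_between all_map; apply: sub_all sb => a /=; rewrite normrN.
exists `|p|%N, t; split=> //; last by rewrite normE.
have := cf_val_norm_le R s u sb; rewrite -normE ler_pdivrMr; last first.
  by rewrite ltr0n expn_gt0.
move=> le_p; rewrite -(ltr_nat R); apply: le_lt_trans le_p _.
have : 0 < (2 ^ k)%:R :> R by rewrite ltr0n expn_gt0.
by move=> ?; lra.
Qed.

Theorem theorem5p3 (R : realType) (k m : nat) (hk : (1 <= k)%N)
    (hm : m = (2 ^ k)%N) :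
  exists a : nat,
    [/\ odd a, (1 <= a < m)%N & hK (a%:R / m%:R : R[i]) <= 8].
Proof.
rewrite hm; have v0 : cf_val R [:: -2] = - (1 / 2) by rewrite /=; field.
have [->|k1] := eqVneq k 1%N.
  (* Halves round up, so [1 / 2] has [a_0 = 1] and remainder [- 1 / 2]. *)
  exists 1%N; split=> //; apply: (@hK_ratio_le R 8 1 [:: -2]) => //.
  - by split=> //=; apply/andP; split; lra.
  - by rewrite v0; apply/andP; split; lra.
  - by rewrite v0; field.
have [->|k5] := eqVneq k 5%N.
  (* Here [15 / 32 = 1 / (2 + 1 / (8 - 1 / 2))]; the last tail [- 1 / 2] lies on the closed end of
     the interval. *)
  have v1 : cf_val R [:: 8; -2] = 2 / 15 by rewrite /= in v0 *; rewrite v0; field.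
  have v2 : cf_val R [:: 2; 8; -2] = 15 / 32.
    by rewrite /= in v1 *; rewrite v1; field.
  exists 15%N; split=> //; apply: (@hK_ratio_le R 8 0 [:: 2; 8; -2]) => //.
  - split=> //; first by rewrite v1; apply/andP; split; lra.
    split=> //; first by rewrite v0; apply/andP; split; lra.
    by split=> //=; apply/andP; split; lra.
  - by rewrite v2; apply/andP; split; lra.
  - by rewrite v2 add0r.
have [|a [s [aodd am sb aE]]] := @pow2_expansion_ratio R 8 k.
  by apply: pow2_expansion_3_8; lia.
exists a; split=> //; first by rewrite am andbT odd_gt0.
apply: (@hK_ratio_le R 8 0 s) => //; last by rewrite add0r.
- exact: nearest_admissible_digits_between.
- exact: cf_val_itv sb.
Qed.
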